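(* Let $(W,S)$ be a finite Coxeter system. For all $\sigma,\omega\in W$ and $J\subseteq S$, the formulas $$\check{R}_{\sigma,\omega}=\sum_{\kappa\in W_J\,:\,\sigma\leq\kappa\cdot{}^J\sigma\leq\omega}\check{R}_{\sigma_J,\kappa}\,\check{R}_{\kappa\cdot{}^J\sigma,\omega,J},\qquad R_{\sigma,\omega}=\sum_{\kappa\in W_J\,:\,\sigma\leq\kappa\cdot{}^J\sigma\leq\omega}R_{\sigma_J,\kappa}\,R_{\kappa\cdot{}^J\sigma,\omega,J}$$ hold. The inverse relation $$R_{\sigma,\omega,J}=\sum_{\kappa\in W_J\,:\,\sigma\leq\kappa\cdot{}^J\sigma\leq\omega}d(R_{\sigma_J,\kappa})\,R_{\kappa\cdot{}^J\sigma,\omega}$$ is valid as well.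
   Context: $(W,S)$ is a Coxeter system with $W$ finite, $\ell$ is the length function, $\leq$ the Bruhat order, $\omega_0$ the longest element of $W$. $\mathcal{L}=\mathbb{Z}[v,v^{-1}]$, and $d:\mathcal{L}\to\mathcal{L}$ is the ring involution with $d(v)=v^{-1}$. The Hecke algebra $\mathcal{H}(W)$ is the $\mathcal{L}$-algebra with basis $\{h_\omega\}_{\omega\in W}$ and relations $h_{\omega_1}h_{\omega_2}=h_{\omega_1\omega_2}$ if $\ell(\omega_1)+\ell(\omega_2)=\ell(\omega_1\omega_2)$, and $(h_s+v)(h_s-v^{-1})=0$ for $s\in S$. The involution $d$ extends to a ring involution of $\mathcal{H}(W)$ with $d(h_\omega)=(h_{\omega^{-1}})^{-1}$. $\langle\,,\rangle$ is the natural pairing of $\mathcal{H}(W)^*=\mathrm{Hom}_{\mathcal{L}}(\mathcal{H}(W),\mathcal{L})$ with $\mathcal{H}(W)$; $\{h^\omega\}_{\omega\in W}$ is the basis of $\mathcal{H}(W)^*$ dual to $\{h_\omega\}_{\omega\in W}$; $d^*(\phi)=d\circ\phi\circ d$ for $\phi\in\mathcal{H}(W)^*$. The $R$-polynomials are $\check R_{\sigma,\omega}=\langle d^*(h^\sigma),h_\omega\rangle\in\mathcal{L}$, with normalized variants $R_{\sigma,\omega}=v^{\ell(\sigma)-\ell(\omega)}\check R_{\sigma,\omega}$, for $\sigma,\omega\in W$. For $\omega,\tau\in W$, put $f_{\omega,\tau}=h_\tau^{-1}h_{\tau\omega}$; for fixed $\tau$, $\{f_{\omega,\tau}\}_{\omega\in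 W}$ is a basis of $\mathcal{H}(W)$, with dual basis $\{f^{\omega,\tau}\}_{\omega\in W}$ of $\mathcal{H}(W)^*$. For $J\subseteq S$, $W_J$ is the subgroup of $W$ generated by $J$ and $\omega_0^J$ is its longest element; every $\sigma\in W$ is uniquely written $\sigma=\sigma_J\,{}^J\sigma$ with $\sigma_J\in W_J$ and ${}^J\sigma$ the minimal length representative of the coset $W_J\sigma$. The $J$-relative $R$-polynomials are $\check R_{\sigma,\omega,J}=\langle f^{\sigma,\omega_0\omega_0^J},h_\omega\rangle\in\mathcal{L}$, with normalized variants $R_{\sigma,\omega,J}=v^{\ell(\sigma)-\ell(\omega)}\check R_{\sigma,\omega,J}$.
   Formalization: The inverse relation is stated for the unnormalized Ř instead of R: Ř_{σ,ω,J} = Σ d(Ř_{σ_J,κ}) Ř_{κ·^Jσ,ω}. As printed with normalized R it fails, e.g. W={1,s}, J=S, σ=1, ω=s: the left side is 0, the right side v²+v⁻²−2. *)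

(* Defs.v *)
From HB Require Import structures.
From mathcomp Require Import all_boot all_order all_algebra all_fingroup.
From mathcomp Require Import boolp.

Set Implicit Arguments.
Unset Strict Implicit.
Unset Printing Implicit Defensive.

Import GRing.Theory.

Local Open Scope ring_scope.

(* Z[v, v^-1] is realised as the subring of the fraction field of Z['X]       *)
(* consisting of the fractions p / 'X^n.                                      *)

Notation ratfun := {fraction {poly int}}.

Definition ratX : ratfun := tofrac 'X.

Definition is_laurent : {pred ratfun} :=
  fun x => `[< exists (p : {poly int}) (n : nat), x * ratX ^+ n = tofrac p >].

Lemma laurentP (x : ratfun) :
  reflect (exists (p : {poly int}) (n : nat), x * ratX ^+ n = tofrac p)
          (x \in is_laurent).
Proof. exact: asboolP. Qed.

Lemma ratX_neq0 : ratX != 0.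
Proof. by rewrite tofrac_eq0 polyX_eq0. Qed.

Lemma is_laurent_subring : subring_closed is_laurent.
Proof.
split; first by apply/laurentP; exists 1, 0%N; rewrite expr0 mulr1 tofrac1.
- move=> x y /laurentP[p [n ex]] /laurentP[q [m ey]]; apply/laurentP.
  exists (p * 'X^m - q * 'X^n), (n + m)%N.
  rewrite tofracB !tofracM !tofracXn -/ratX -ex -ey exprD mulrBl.
  by congr (_ - _); rewrite ?mulrA // -!mulrA [ratX ^+ n * _]mulrC.
- move=> x y /laurentP[p [n ex]] /laurentP[q [m ey]]; apply/laurentP.
  by exists (p * q), (n + m)%N; rewrite tofracM -ex -ey exprD mulrACA.
Qed.

HB.instance Definition _ :=
  GRing.isSubringClosed.Build ratfun is_laurent is_laurent_subring.

Record laurent := Laurent { laurent_val : ratfun; _ : laurent_val \in is_laurent }.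

HB.instance Definition _ := [isSub for laurent_val].
HB.instance Definition _ := [Choice of laurent by <:].
HB.instance Definition _ := [SubChoice_isSubComNzRing of laurent by <:].

Lemma laurent_valP (x : laurent) : laurent_val x \in is_laurent.
Proof. exact: (valP x). Qed.

Definition laurent_unit : {pred laurent} :=
  fun x => (laurent_val x != 0) && ((laurent_val x)^-1 \in is_laurent).

Definition laurent_inv (x : laurent) : laurent := insubd x (laurent_val x)^-1.

Lemma laurent_mulVx : {in laurent_unit, left_inverse 1 laurent_inv *%R}.
Proof.
move=> x /andP[x0 xV]; apply: val_inj.
by rewrite rmorphM rmorph1 /laurent_inv /= val_insubd xV mulVf.
Qed.

Lemma laurent_unitPl (x y : laurent) : y * x = 1 -> laurent_unit x.
Proof.
move=> /(congr1 laurent_val); rewrite [LHS](rmorphM val) [RHS](rmorph1 val) => yx1.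
have x0 : laurent_val x != 0.
  apply: contra_eq_neq yx1 => x0.
  by rewrite /= x0 mulr0 eq_sym oner_neq0.
rewrite /laurent_unit x0 /=; suff -> : (laurent_val x)^-1 = laurent_val y.
  exact: laurent_valP.
by apply: (mulIf x0); rewrite mulVf.
Qed.

Lemma laurent_inv_out : {in [predC laurent_unit], laurent_inv =1 id}.
Proof.
move=> x; rewrite inE unfold_in negb_and negbK => /orP[/eqP x0 | xV].
  apply: val_inj; rewrite /laurent_inv val_insubd; case: ifP => // _.
  by rewrite /= x0 invr0.
by rewrite /laurent_inv /insubd insubN.
Qed.

HB.instance Definition _ := GRing.ComNzRing_hasMulInverse.Build laurent
  laurent_mulVx laurent_unitPl laurent_inv_out.

Lemma ratX_laurent : ratX \in is_laurent.
Proof. by apply/laurentP; exists 'X, 0%N; rewrite expr0 mulr1. Qed.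

Lemma ratXV_laurent : ratX^-1 \in is_laurent.
Proof.
by apply/laurentP; exists 1, 1%N; rewrite expr1 mulVf ?ratX_neq0 ?tofrac1.
Qed.

Definition v : laurent := Laurent ratX_laurent.

Lemma v_unit : v \is a GRing.unit.
Proof. by rewrite unfold_in /= /laurent_unit ratX_neq0 ratXV_laurent. Qed.

Lemma laurent_val_vV : laurent_val v^-1 = ratX^-1.
Proof. by rewrite /= /laurent_inv val_insubd ratXV_laurent. Qed.

(* The involution d: if x = p(v) / v^n then d x = p(v^-1) * v^n, which does   *)
(* not depend on the choice of p and n (laurent_barE).  It is the ring        *)
(* morphism that sends v to v^-1 (laurent_bar_v).                             *)

Definition evalV (p : {poly int}) : ratfun := (map_poly intr p).[ratX^-1].

Lemma evalVM p q : evalV (p * q) = evalV p * evalV q.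
Proof. by rewrite /evalV rmorphM hornerM. Qed.

Lemma evalVB p q : evalV (p - q) = evalV p - evalV q.
Proof. by rewrite /evalV rmorphB hornerD hornerN. Qed.

Lemma evalVXn n : evalV 'X^n = ratX ^- n.
Proof. by rewrite /evalV rmorphXn /= map_polyX hornerXn exprVn. Qed.

Lemma evalV_laurent p : evalV p \in is_laurent.
Proof.
rewrite /evalV horner_coef; apply: rpred_sum => i _.
by rewrite coef_map rpredM ?rpred_int ?rpredX ?ratXV_laurent.
Qed.

Definition laurent_num (x : laurent) : {poly int} :=
  projT1 (cid (laurentP _ (laurent_valP x))).

Definition laurent_exp (x : laurent) : nat :=
  projT1 (cid (projT2 (cid (laurentP _ (laurent_valP x))))).

Lemma laurent_numE x :
  laurent_val x * ratX ^+ laurent_exp x = tofrac (laurent_num x).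
Proof. exact: (projT2 (cid (projT2 (cid (laurentP _ (laurent_valP x)))))). Qed.

Lemma laurent_bar_subproof x :
  evalV (laurent_num x) * ratX ^+ laurent_exp x \in is_laurent.
Proof. by rewrite rpredM ?evalV_laurent ?rpredX ?ratX_laurent. Qed.

Definition laurent_bar (x : laurent) : laurent :=
  Laurent (laurent_bar_subproof x).

Lemma laurent_barE (x : laurent) (p : {poly int}) (n : nat) :
  laurent_val x * ratX ^+ n = tofrac p ->
  laurent_val (laurent_bar x) = evalV p * ratX ^+ n.
Proof.
move=> xp; have xq := laurent_numE x; rewrite /laurent_bar /=.
move: (laurent_num x) (laurent_exp x) xq => q m xq.
have ratXn k : ratX ^+ k != 0 by rewrite expf_neq0 ?ratX_neq0.
have pq : p * 'X^m = q * 'X^n.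
  apply/eqP; rewrite -tofrac_eq !tofracM !tofracXn -xp -xq -!mulrA.
  by rewrite [ratX ^+ n * _]mulrC.
have /(congr1 evalV) := pq; rewrite !evalVM !evalVXn => e.
apply: (mulIf (invr_neq0 (ratXn n))); rewrite mulfK // mulrAC -e.
by rewrite mulfVK.
Qed.

Lemma laurent_bar_zmod_morphism : zmod_morphism laurent_bar.
Proof.
move=> x y; have /laurentP[p [n ex]] := laurent_valP x.
have /laurentP[q [m ey]] := laurent_valP y.
have exy : laurent_val (x - y) * ratX ^+ (n + m) = tofrac (p * 'X^m - q * 'X^n).
  rewrite [laurent_val _](rmorphB val) /= tofracB !tofracM !tofracXn -/ratX.
  rewrite -ex -ey exprD mulrBl.
  by congr (_ - _); rewrite ?mulrA // -!mulrA [ratX ^+ n * _]mulrC.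
apply: val_inj; transitivity (evalV p * ratX ^+ n - evalV q * ratX ^+ m).
  rewrite [LHS](laurent_barE exy).
  have ratXn k : ratX ^+ k != 0 by rewrite expf_neq0 ?ratX_neq0.
  rewrite evalVB !evalVM !evalVXn exprD mulrBl.
  by congr (_ - _); rewrite mulrA; [rewrite mulrAC mulfVK | rewrite mulfVK].
rewrite -(laurent_barE ex) -(laurent_barE ey).
by symmetry; exact: (rmorphB val).
Qed.

Lemma laurent_bar_monoid_morphism : monoid_morphism laurent_bar.
Proof.
split=> [|x y]; apply: val_inj.
  rewrite [LHS](@laurent_barE _ 1 0) ?expr0 ?mulr1 ?tofrac1 //.
  by rewrite /evalV rmorph1 hornerC.
have /laurentP[p [n ex]] := laurent_valP x.
have /laurentP[q [m ey]] := laurent_valP y.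
have exy : laurent_val (x * y) * ratX ^+ (n + m) = tofrac (p * q).
  by rewrite tofracM -ex -ey [laurent_val _](rmorphM val) exprD mulrACA.
rewrite [LHS](laurent_barE exy) evalVM exprD mulrACA.
rewrite -(laurent_barE ex) -(laurent_barE ey).
by symmetry; exact: (rmorphM val).
Qed.

HB.instance Definition _ := GRing.isZmodMorphism.Build laurent laurent
  laurent_bar laurent_bar_zmod_morphism.
HB.instance Definition _ := GRing.isMonoidMorphism.Build laurent laurent
  laurent_bar laurent_bar_monoid_morphism.

Lemma laurent_bar_v : laurent_bar v = v^-1.
Proof.
apply: val_inj; rewrite [RHS]laurent_val_vV.
rewrite [LHS](@laurent_barE v 'X 0) ?expr0 ?mulr1 //.
by rewrite /evalV map_polyX hornerX.
Qed.

(* Finite Coxeter systems.  The exponent #[s * t] is the Coxeter number       *)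
(* m(s, t), with m(s, s) = 1, and the last clause says that W is presented by *)
(* the generators S and the relations (s * t) ^+ m(s, t) = 1.                 *)

Definition coxeter_system (W : finGroupType) (S : {set W}) : Prop :=
  [/\ <<S>>%g = [set: W],
      {in S, forall s, #[s]%g = 2%N}
    & forall (G : groupType) (f : W -> G),
        {in S &, forall s t, ((f s * f t) ^+ #[s * t] = 1)%g} ->
        exists phi : W -> G,
          {morph phi : x y / (x * y)%g >-> (x * y)%g} /\ {in S, phi =1 f}].

Section CoxeterNotions.

Variables (W : finGroupType) (S : {set W}).
Implicit Types (x y s t : W) (J : {set W}).

(* S ^+ n is the set of products of n elements of S.  The search stops before *)
(* #|W| because the prefixes of a reduced word are pairwise distinct.         *)
Definition cox_length x : nat :=
  find (fun n => x \in (S ^+ n)%g) (iota 0 #|W|).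

Definition reflections : {set W} := class_support S [set: W].

Definition bruhat : rel W :=
  connect [rel x y | [exists t in reflections, y == (x * t)%g]
                     && (cox_length x < cox_length y)%N].

(* W_J is <<J>>, and its length function is the restriction of cox_length.    *)
Definition longest J : W := [arg max_(x > 1%g in <<J>>%g) cox_length x].

Definition min_rep J x : W := [arg min_(y < x in (<<J>> :* x)%g) cox_length y].

Definition parab_part J x : W := (x * (min_rep J x)^-1)%g.

End CoxeterNotions.

Section DualBasis.

Variables (R : comNzRingType) (V : lmodType R) (I : finType).

Definition is_basis (b : I -> V) : Prop :=
  forall x : V, exists! c : {ffun I -> R}, x = \sum_i c i *: b i.

Definition is_dual (b : I -> V) (i : I) (phi : {scalar V}) : Prop :=
  forall j, phi (b j) = (i == j)%:R.

(* The i-th element of the dual basis; the default value 0 is only used when  *)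
(* b has no dual family, so never when b is a basis.                          *)
Definition dual_basis (b : I -> V) (i : I) : {scalar V} :=
  if pselect (exists phi, is_dual b i phi) is left ex then projT1 (cid ex)
  else \0.

End DualBasis.

Section Hecke.

Variables (W : finGroupType) (S : {set W}).
Variables (H : unitAlgType laurent) (h : W -> H).
Implicit Types (x y : W) (J : {set W}).

Local Notation ell := (cox_length S).

Definition hecke_algebra : Prop :=
  [/\ is_basis h,
      forall x y, (ell x + ell y = ell (x * y)%g)%N -> h x * h y = h (x * y)%g
    & {in S, forall s, (h s + v%:A) * (h s - v^-1%:A) = 0}].

Definition hecke_bar (a : H) : H :=
  \sum_x laurent_bar (dual_basis h x a) *: (h x^-1%g)^-1.

Definition dual_bar (phi : H -> laurent) : H -> laurent :=
  laurent_bar \o phi \o hecke_bar.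

Definition Rcheck x y : laurent := dual_bar (dual_basis h x) (h y).

Definition Rpoly x y : laurent := v ^ ((ell x)%:Z - (ell y)%:Z) * Rcheck x y.

Definition hecke_f x y : H := (h y)^-1 * h (y * x)%g.

Definition Rcheck_rel J x y : laurent :=
  dual_basis (hecke_f^~ (longest S S * longest S J)%g) x (h y).

Definition Rpoly_rel J x y : laurent :=
  v ^ ((ell x)%:Z - (ell y)%:Z) * Rcheck_rel J x y.

End Hecke.

(* Main.v *)
From HB Require Import structures.
Require Import Defs.
From mathcomp Require Import all_boot all_order all_algebra all_fingroup.
Import GRing.Theory.
Local Open Scope ring_scope.

Set Implicit Arguments.
Unset Strict Implicit.
Unset Printing Implicit Defensive.

(* Put hb x = (h x^-1)^-1, the image of h x under the bar involution.  Then   *)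
(* Rcheck x w is the coefficient of h w on hb x, and d (Rcheck x w) that of   *)
(* hb w on h x.  For k in W_J and x a minimal coset representative, the       *)
(* element f_{k x, w0 w0^J} equals h k * hb x, while hb (k x) = hb k * hb x.  *)
(* So the two bases f and hb differ only by the change of basis between h k   *)
(* and hb k for k in W_J, whose coefficients are Rcheck and d Rcheck;         *)
(* comparing coefficients gives the two formulas.  The restriction to Bruhat  *)
(* intervals is harmless because the omitted terms vanish, by the lifting     *)
(* property.                                                                  *)

(** * Coxeter systems *)

(** The element [tau] = w0 w0^J is chosen so that f_{kx} = h k * hb x for k in W_J and x minimal in
    its coset ([hecke_fE]). Expanding h k on the hb u with u in W_J then expresses f on [hb] with
    coefficients Rcheck u k ([hecke_f_expansion]), and expanding hb k on the h u gives the inverse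
    matrix ([bar_basis_expansion]). Comparing the coordinates of h omega in the two bases yields
    [Rcheck_sum] and [Rcheck_rel_sum]; [coset_sum] discards the terms outside the Bruhat interval.

    The expansions of h on [hb] and of [hb] on h, with their Bruhat support, come from one induction
    along reduced words ([parabolic_expansion]). The combinatorics rests on the cocycle of
    [inversion_cocycle]: it gives strong exchange and the symmetric difference rule for inversion
    sets, whose cardinals are lengths. Additivity of length on cosets, the length of w0^J u and the
    lifting property follow. *)

Section CoxeterSystems.

Local Open Scope nat_scope.
Local Open Scope group_scope.

Variables (W : finGroupType) (S : {set W}).
Hypothesis coxS : coxeter_system S.
Implicit Types (r s t x y z : W).

Lemma cox_mulss s : s \in S -> s * s = 1.
Proof.
case: coxS => _ ordS _ sS; rewrite -[RHS](expg_order s) (ordS _ sS).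
by rewrite expgS expg1.
Qed.

Lemma cox_invs s : s \in S -> s^-1 = s.
Proof. by move/cox_mulss/eqP; rewrite -eq_invg_mul => /eqP. Qed.

(* The flips extend to an action of W on W x {+1, -1}, whose sign tells, for  *)
(* a reflection r, whether ell (r * w) < ell w.                               *)
Definition flip s (p : W * bool) : W * bool := (p.1 ^ s, p.2 (+) (p.1 == s)).

Lemma flip_inj s : injective (flip s).
Proof. by move=> [a e] [b f] [/conjg_inj-> /addIb->]. Qed.

Definition flip_perm s : {perm W * bool} := perm (@flip_inj s).

(** Step 2k meets s exactly when r s = (s t)^(2k), and step 2k+1 meets t exactly when r s = (s
    t)^(2k+1); the sign counts these hits modulo 2. *)
Lemma flip_permX s t n r e : s \in S -> t \in S ->
  ((flip_perm s * flip_perm t) ^+ n) (r, e) =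
  (r ^ ((s * t) ^+ n),
   e (+) odd (\sum_(0 <= j < n.*2) (r * s == (s * t) ^+ j)%g)).
Proof.
move=> sS tS; elim: n => [|n IH].
  by rewrite !expg0 perm1 conjg1 big_geq // addbF.
have cst k : s * (s * t) ^- k = (s * t) ^+ k * s.
  elim: k => [|k IHk]; first by rewrite expg0 invg1 mulg1 mul1g.
  rewrite [in RHS]expgS expgSr invMg mulgA (_ : s * (s * t)^-1 = s * t * s).
    by rewrite -[s * t * s * _]mulgA IHk !mulgA.
  by rewrite invMg !cox_invs // mulgA.
have conjs k : (r ^ ((s * t) ^+ k) == s) = (r * s == (s * t) ^+ k.*2).
  rewrite (canF_eq (conjgK _)) conjgE invgK cst mulgA.
  by rewrite -expgnDr addnn (canF_eq (mulgK s)) cox_invs.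
rewrite expgSr permM IH permM !permE /flip /= doubleS !big_nat_recr //=.
rewrite -!conjgM !oddD !oddb !addbA; congr (_, _ (+) _ (+) _).
- by rewrite expgSr.
- exact: conjs.
- rewrite conjgM (canF_eq (conjgK s)) (canF_eq (conjgK _)) 2!conjgE !invgK.
  rewrite cox_invs // !mulgA -[_ * s * _]mulgA -mulgA -mulgA cst.
  rewrite (canF_eq (mulgK s)) cox_invs // -addnn -addnS expgnDr expgS.
  by rewrite !mulgA.
Qed.

(* Since (s t)^j = (s t)^(j + m) for m = #[s * t], the sum in flip_permX      *)
(* counts every hit twice.                                                    *)
Lemma braid_flip_perm s t : s \in S -> t \in S ->
  (flip_perm s * flip_perm t) ^+ #[s * t] = 1.
Proof.
move=> sS tS; apply/permP=> -[r e]; rewrite flip_permX // perm1 expg_order.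
rewrite conjg1 -addnn (@big_cat_nat _ _ _ #[s * t]) ?leq_addr //=.
rewrite -[X in index_iota X (_ + _)]add0n big_addn addnK.
under [X in _ + X]eq_bigr => j _ do rewrite expgnDr expg_order mulg1.
by rewrite addnn odd_double addbF.
Qed.

Lemma mem_gen_word (A : {set W}) x : x \in <<A>> ->
  exists2 l, {subset l <= A} & x = \prod_(s <- l) s.
Proof.
case/gen_prodgP=> n [c cA ->]; exists [seq c i | i <- index_enum 'I_n].
  by move=> s /mapP[i _ ->].
by rewrite big_map.
Qed.

Lemma mem_word_gen (A : {set W}) l : {subset l <= A} ->
  \prod_(s <- l) s \in <<A>>.
Proof.
move=> lA; rewrite big_seq; apply: group_prod => s /lA; exact: mem_gen.
Qed.

(** The presentation of W enters here: by [braid_flip_perm] the flips extend to an action. [eta x r]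
    is the sign change at r, which does not depend on the starting sign, whence the cocycle rule. *)
Lemma inversion_cocycle : exists eta : W -> W -> bool,
  (forall x y r, eta (x * y) r = eta x r (+) eta y (r ^ x))
  /\ {in S, forall s r, eta s r = (r == s)}.
Proof.
have [genS _ /(_ _ flip_perm)[|phi [phiM phiS]]] := coxS.
  exact: braid_flip_perm.
have phi1 : phi 1 = 1 by apply: (mulgI (phi 1)); rewrite -phiM !mulg1.
have phiE x r e : phi x (r, e) = (r ^ x, e (+) (phi x (r, false)).2).
  have /mem_gen_word[l lS ->] : x \in <<S>> by rewrite genS inE.
  elim: l lS r e => [|s l IH] lS r e.
    by rewrite big_nil phi1 !perm1 conjg1 addbF.
  have [sS {}lS] : s \in S /\ {subset l <= S}.
    by split=> [|t tl]; apply: lS; rewrite inE ?eqxx ?tl ?orbT.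
  rewrite big_cons phiM !permM (phiS s) // !permE /flip /= IH // [in RHS]IH //=.
  by rewrite conjgM addbA.
exists (fun x r => (phi x (r, false)).2); split=> [x y r | s sS r].
  by rewrite phiM permM phiE [in LHS]phiE.
by rewrite phiS // permE.
Qed.

(** * Words, reduced expressions and length *)

Lemma expgs_wordP (A : {set W}) n x :
  reflect (exists l, [/\ {subset l <= A}, size l = n & x = \prod_(s <- l) s])
          (x \in A ^+ n).
Proof.
apply: (iffP idP) => [|[l [lA <- ->]]].
  elim: n x => [|n IH] x.
    by rewrite expg0 => /set1P->; exists [::]; rewrite big_nil.
  rewrite expgS => /mulsgP[s y sA /IH[l [lA <- ->]] ->].
  exists (s :: l); split=> //; last by rewrite big_cons.
  by move=> t; rewrite inE => /predU1P[-> | /lA].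
elim: l lA => [|s l IH] lA; first by rewrite big_nil expg0 set11.
rewrite big_cons expgS mem_mulg ?lA ?mem_head ?IH // => t tl.
by apply: lA; rewrite inE tl orbT.
Qed.

Lemma cox_length_prod l : {subset l <= S} ->
  cox_length S (\prod_(s <- l) s) <= size l.
Proof.
move=> lS; rewrite leqNgt /cox_length; apply/negP => lt_l.
have /(before_find 0) := lt_l; rewrite nth_iota; last first.
  by apply: leq_trans lt_l _; rewrite -[X in _ <= X](size_iota 0) find_size.
by move/negP; apply; apply/expgs_wordP; exists l.
Qed.

Lemma mem_cox_gen x : x \in <<S>>.
Proof. by case: coxS => -> _ _; rewrite inE. Qed.

Definition cayley := [rel x y : W | x^-1 * y \in S].

Lemma cayley_connect l y : {subset l <= S} ->
  connect cayley y (y * \prod_(s <- l) s).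
Proof.
elim: l y => [|s l IH] y lS; first by rewrite big_nil mulg1 connect0.
rewrite big_cons mulgA; apply: (@connect_trans _ _ (y * s)).
  by apply: connect1; rewrite /= mulKg lS ?mem_head.
by apply: IH => t tl; apply: lS; rewrite inE tl orbT.
Qed.

Lemma cayley_path_word p y : path cayley y p ->
  exists l, [/\ {subset l <= S}, size l = size p
               & last y p = y * \prod_(s <- l) s].
Proof.
elim: p y => [|z p IH] y /=; first by exists [::]; rewrite big_nil mulg1.
case/andP=> yz /IH[l [lS sz_l ->]]; exists (y^-1 * z :: l).
split=> /=; last by rewrite big_cons mulgA mulKVg.
  by move=> t; rewrite inE => /predU1P[-> | /lS].
by rewrite sz_l.
Qed.

(** A path without repetition from 1 to x in the Cayley graph has fewer than #|W| edges, so the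
    bounded search in [cox_length] succeeds. *)
Lemma reduced_word x :
  exists l, [/\ {subset l <= S}, size l = cox_length S x
               & x = \prod_(s <- l) s].
Proof.
suff hasx : has (fun n => x \in S ^+ n) (iota 0 #|W|).
  move: (hasx) => /(nth_find 0); rewrite nth_iota; first by move/expgs_wordP.
  by move: hasx; rewrite has_find size_iota.
have /mem_gen_word[l lS ->] := mem_cox_gen x.
have := cayley_connect 1 lS; rewrite mul1g => /connectP[p1 p1P ->].
case: (shortenP p1P) => p /cayley_path_word[m [mS sz_m pE]] Up _.
apply/hasP; exists (size m); last first.
  by apply/expgs_wordP; exists m; rewrite pE mul1g.
rewrite mem_iota add0n /= sz_m -[_ < _]/(size (1 :: p) <= _).
by rewrite -(card_uniqP Up) max_card.
Qed.

Local Notation ell := (cox_length S).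
Local Notation T := (reflections S).

Lemma cox_length1 : ell 1 = 0.
Proof.
have := @cox_length_prod [::]; rewrite big_nil leqn0 => h.
by apply/eqP/h => s; rewrite in_nil.
Qed.

Lemma cox_lengthM x y : ell (x * y) <= ell x + ell y.
Proof.
have [l [lS <- ->]] := reduced_word x; have [m [mS <- ->]] := reduced_word y.
rewrite -big_cat -size_cat cox_length_prod // => s.
by rewrite mem_cat => /orP[/lS | /mS].
Qed.

Lemma cox_length_eq0 x : (ell x == 0) = (x == 1).
Proof.
apply/idP/eqP => [|->]; last by rewrite cox_length1.
by have [l [_ <- ->]] := reduced_word x; rewrite size_eq0 => /eqP->;
  rewrite big_nil.
Qed.

Lemma cox_lengthV x : ell x^-1 = ell x.
Proof.
suff le y : ell y^-1 <= ell y.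
  by apply/eqP; rewrite eqn_leq le /= -{1}[x]invgK le.
have [l [lS <- ->]] := reduced_word y.
suff -> : (\prod_(s <- l) s)^-1 = \prod_(s <- rev l) s.
  by rewrite -size_rev cox_length_prod // => s; rewrite mem_rev => /lS.
elim: l lS => [|s l IH] lS; first by rewrite !big_nil invg1.
rewrite rev_cons -cats1 big_cat big_seq1 big_cons invMg (@cox_invs s) ?lS
  ?mem_head //.
by rewrite IH // => t tl; apply: lS; rewrite inE tl orbT.
Qed.

(** * Reflections, strong exchange and inversion sets *)

Lemma reflectionJ r x : (r ^ x \in T) = (r \in T).
Proof.
suff imp t y : t \in T -> t ^ y \in T.
  by apply/idP/idP; [rewrite -{2}[r](conjgK x) | ]; apply: imp.
by case/imset2P=> s z sS _ ->; rewrite -conjgM memJ_class_support ?inE.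
Qed.

Lemma reflection_gen s : s \in S -> s \in T.
Proof. by move=> sS; apply/imset2P; exists s 1; rewrite ?inE ?conjg1. Qed.

Lemma reflection_mulss r : r \in T -> r * r = 1.
Proof. by case/imset2P=> s x sS _ ->; rewrite -conjMg cox_mulss // conj1g. Qed.

(** For x = s1...sk, [eta x r] is the parity of the number of i such that r x is the word with si
    deleted by conjugation, that is r = s1...si...s1. If it is odd, r x is shorter than x. If it is
    even, [eta (r * x) r] holds because [eta r r] does, and x is shorter than r x. *)
Lemma strong_exchange : exists eta : W -> W -> bool,
  [/\ forall x y r, eta (x * y) r = eta x r (+) eta y (r ^ x),
      {in S, forall s r, eta s r = (r == s)},
      forall l r, {subset l <= S} -> eta (\prod_(s <- l) s) r ->
        exists m, [/\ {subset m <= l}, (size m).+1 = size l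
                     & r * \prod_(s <- l) s = \prod_(s <- m) s],
      {in T, forall r, eta r r}
    & forall x r, r \in T -> (ell (r * x) < ell x) = eta x r].
Proof.
have [eta [etaM etaS]] := inversion_cocycle.
have eta1 r : eta 1 r = false.
  by have := etaM 1 1 r; rewrite mulg1 conjg1; case: (eta 1 r).
have del l r : {subset l <= S} -> eta (\prod_(s <- l) s) r ->
    exists m, [/\ {subset m <= l}, (size m).+1 = size l
                 & r * \prod_(s <- l) s = \prod_(s <- m) s].
  elim: l r => [|s l IH] r lS; first by rewrite big_nil eta1.
  have sS : s \in S by rewrite lS ?mem_head.
  rewrite big_cons etaM etaS //; case: eqP => [-> _ | _ /= eta_l].
    exists l; split=> // [t tl|]; first by rewrite inE tl orbT.
    by rewrite mulgA cox_mulss ?mul1g.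
  have [|m [ml <- mE]] := IH _ _ eta_l.
    by move=> t tl; apply: lS; rewrite inE tl orbT.
  exists (s :: m); split=> // [t|].
    by rewrite !inE => /predU1P[->|/ml->]; rewrite ?eqxx ?orbT.
  by rewrite big_cons -mE conjgE !mulgA mulgV mul1g.
have eta_lt x r : eta x r -> ell (r * x) < ell x.
  have [l [lS <- ->]] := reduced_word x => /del[] // m [ml <- ->].
  by rewrite ltnS cox_length_prod // => s /ml/lS.
have eta_rr : {in T, forall r, eta r r}.
  move=> _ /imset2P[s y sS _ ->].
  (* In [eta (s ^ y) (s ^ y)] the factors y^-1 and y contribute [eta y^-1 (s ^ y)] and [eta y s],
     which cancel because [eta 1] vanishes. *)
  have := etaM y^-1 y (s ^ y).
  rewrite mulVg eta1 conjgK => /esym etay.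
  rewrite {1}conjgE !etaM conjgK (etaS s) // eqxx [s ^ s]conjgE mulKg.
  by move: etay; case: (eta y^-1 _) (eta y s) => [] [].
exists eta; split=> // x r rT; apply/idP/idP=> [lt_rx|/eta_lt//].
apply: contraLR lt_rx => n_eta; rewrite -leqNgt ltnW //.
have /eta_lt : eta (r * x) r.
  by rewrite etaM eta_rr // conjgE mulKg (negPf n_eta).
by rewrite mulgA reflection_mulss // mul1g.
Qed.

Definition inversions x : {set W} := [set r in T | ell (r * x) < ell x].

(** With N(x) for [inversions x], the cocycle rule says that N(x y) is the symmetric difference of
    N(x) and x N(y) x^-1. *)
Lemma inversionsM x y r : r \in T ->
  (r \in inversions (x * y)) =
    (r \in inversions x) (+) (r ^ x \in inversions y).
Proof.
have [eta [etaM _ _ _ etaE]] := strong_exchange => rT.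
by rewrite !inE reflectionJ !etaE ?reflectionJ // rT etaM.
Qed.

Lemma inversions_gen s : s \in S -> inversions s = [set s].
Proof.
have [eta [_ etaS _ _ etaE]] := strong_exchange => sS.
apply/setP=> r; rewrite !inE; case: (boolP (r \in T)) => [rT|nrT] /=.
  by rewrite etaE // etaS.
by apply/esym/negbTE; apply: contraNneq nrT => ->; apply: reflection_gen.
Qed.

Lemma reflection_lt r x : r \in T ->
  (ell x < ell (r * x)) = (r \notin inversions x).
Proof.
have [eta [etaM _ _ etaT etaE]] := strong_exchange => rT.
rewrite -{1}[x]mul1g -(reflection_mulss rT) -mulgA etaE // etaM etaT //.
by rewrite conjgE mulKg -etaE // inE rT addTb.
Qed.

Lemma cox_length_cons s x : s \in S ->
  ell (s * x) = if s \in inversions x then (ell x).-1 else (ell x).+1.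
Proof.
move=> sS; have sT := reflection_gen sS.
have ell_s : ell s <= 1.
  have := @cox_length_prod [:: s]; rewrite big_seq1; apply.
  by move=> t; rewrite inE => /eqP->.
have le_sx : ell (s * x) <= (ell x).+1.
  by rewrite (leq_trans (cox_lengthM _ _)) // -add1n leq_add2r.
have le_x : ell x <= (ell (s * x)).+1.
  rewrite -{1}[x]mul1g -(cox_mulss sS) -mulgA.
  by rewrite (leq_trans (cox_lengthM _ _)) // -add1n leq_add2r.
case: ifPn => [|]; last by rewrite -reflection_lt // => ?; apply/eqP;
  rewrite eqn_leq le_sx.
rewrite inE sT /= => lt; apply/eqP; rewrite eqn_leq -!subn1 leq_subLR add1n
  le_x.
by rewrite -ltnS subn1 prednK ?lt // (leq_ltn_trans _ lt).
Qed.

(** * Parabolic subgroups *)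

Section Parabolic.

Variable J : {set W}.
Hypothesis subJS : J \subset S.
Local Notation WJ := <<J>>.

(** Exchange only deletes letters, so a word in J can be shortened to a reduced one without leaving
    J. *)
Lemma parabolic_word x : x \in WJ ->
  exists l, [/\ {subset l <= J}, size l = ell x & x = \prod_(s <- l) s].
Proof.
have JS := subsetP subJS.
case/mem_gen_word => l lJ ->; elim: l lJ => [|s l IH] lJ.
  by exists [::]; rewrite big_nil cox_length1.
have sJ : s \in J by rewrite lJ ?mem_head.
have [t tl|m [mJ sz_m lE]] := IH; first by apply: lJ; rewrite inE tl orbT.
rewrite big_cons cox_length_cons ?JS // lE.
case: ifPn => [|_]; last first.
  exists (s :: m); rewrite big_cons -lE /= sz_m; split=> // t.
  by rewrite inE => /predU1P[->|/mJ].
have [eta [_ _ del _ etaE]] := strong_exchange.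
rewrite inE => /andP[sT]; rewrite etaE // => /del[t /mJ/JS//|].
move=> n [nm sz_n nE]; exists n; rewrite nE -lE -sz_m -sz_n.
by split=> // t /nm/mJ.
Qed.

Lemma parabolic_ind (P : W -> Prop) :
  P 1 ->
  (forall s x, s \in J -> x \in WJ -> ell (s * x) = (ell x).+1 -> P x ->
     P (s * x)) ->
  forall x, x \in WJ -> P x.
Proof.
have JS := subsetP subJS.
move=> P1 Ps x /parabolic_word[l [lJ + xE]]; rewrite {x}xE.
elim: l lJ => [|s l IH] lJ; first by rewrite big_nil.
have sJ : s \in J by rewrite lJ ?mem_head.
have {}lJ : {subset l <= J} by move=> t tl; apply: lJ; rewrite inE tl orbT.
rewrite big_cons /= => sz.
have le_l : ell (\prod_(t <- l) t) <= size l by apply: cox_length_prod => t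
  /lJ/JS.
have sz_l : size l = ell (\prod_(t <- l) t).
  apply/eqP; rewrite eqn_leq le_l andbT -ltnS sz.
  by rewrite cox_length_cons ?JS //; case: ifP => // _;
    rewrite (leq_trans (leq_pred _)).
by apply: Ps; rewrite ?mem_word_gen -?sz -?sz_l //; apply: IH.
Qed.

Lemma inversions_parabolic x : x \in WJ -> inversions x \subset WJ.
Proof.
have JS := subsetP subJS.
elim/parabolic_ind => [|s y sJ yJ _ IH]; apply/subsetP => r.
  by rewrite inE mulg1 cox_length1 ltn0 andbF.
move=> r_sy; have rT : r \in T by move: r_sy; rewrite inE => /andP[].
have sWJ := mem_gen sJ.
move: r_sy; rewrite inversionsM // inversions_gen ?JS // inE.
case: eqP => [->//|_ /=] /(subsetP IH).
by rewrite groupJr.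
Qed.

End Parabolic.

Lemma inversionsM_set x y :
  inversions (x * y) =
  (inversions x :\: inversions y :^ x^-1) :|: (inversions y :^ x^-1 :\:
    inversions x).
Proof.
apply/setP => r; rewrite !inE !mem_conjgV.
case: (boolP (r \in T)) => [rT|nrT].
  have := inversionsM x y rT; rewrite !inE rT reflectionJ rT /= => ->.
  by case: (_ < _); case: (_ < _).
by rewrite !inE reflectionJ (negPf nrT).
Qed.

(** At an ascent, N(s y) is the disjoint union of {s} and s N(y) s. *)
Lemma card_inversions x : #|inversions x| = ell x.
Proof.
have := mem_cox_gen x.
elim/(parabolic_ind (subxx S)) => [|s y sS _ ell_sy IH].
  rewrite cox_length1; apply/eqP; rewrite cards_eq0; apply/eqP/setP=> r.
  by rewrite !inE mulg1 cox_length1 ltn0 andbF.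
have s_y : s \notin inversions y.
  by rewrite -reflection_lt ?reflection_gen // ell_sy.
have s_ys : s \notin inversions y :^ s^-1.
  by rewrite mem_conjgV conjgE mulKg.
have -> : inversions (s * y) = s |: inversions y :^ s^-1.
  rewrite inversionsM_set inversions_gen //; apply/setP=> r.
  by rewrite !inE; case: eqP => [->|_]; rewrite ?(negPf s_ys) //= andbF.
by rewrite cardsU1 s_ys cardJg IH ell_sy.
Qed.

Lemma cox_length_ascent s x : s \in S -> ell x < ell (s * x) ->
  ell (s * x) = (ell s + ell x)%N.
Proof.
move=> sS; rewrite reflection_lt ?reflection_gen // => s_x.
rewrite cox_length_cons // (negPf s_x).
by rewrite -[ell s]card_inversions inversions_gen // cards1.
Qed.

Lemma cox_length_descent s x : s \in S -> ~~ (ell x < ell (s * x)) ->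
  ell x = (ell s + ell (s * x))%N.
Proof.
move=> sS s_x; have ss := cox_mulss sS.
have := @cox_length_ascent s (s * x) sS; rewrite mulgA ss mul1g; apply.
by move: s_x; rewrite reflection_lt ?reflection_gen // negbK inE => /andP[].
Qed.

Lemma inversions_sub x : inversions x \subset T.
Proof. by apply/subsetP => r; rewrite inE => /andP[]. Qed.

(** * Minimal coset representatives and longest elements *)

Section ParabolicCosets.

Variable J : {set W}.
Hypothesis subJS : J \subset S.
Local Notation WJ := <<J>>.

(** N(u) lies in W_J, while minimality of x keeps N(x), hence u N(x) u^-1, outside W_J: the
    symmetric difference is a disjoint union. *)
Lemma min_length_mul x u : (forall w, w \in WJ -> ell x <= ell (w * x)) ->
  u \in WJ -> ell (u * x) = ell u + ell x.
Proof.
move=> min_x uJ; rewrite -!card_inversions.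
have dis : [disjoint inversions u & inversions x :^ u^-1].
  rewrite disjoints_subset; apply/subsetP=> r r_u.
  have rJ := subsetP (inversions_parabolic subJS uJ) r r_u.
  rewrite in_setC mem_conjgV inE negb_and; apply/orP; right.
  by rewrite -leqNgt min_x // groupJ.
rewrite inversionsM_set; have /setDidPl-> := dis.
have /setDidPl-> : [disjoint inversions x :^ u^-1 & inversions u].
  by rewrite disjoint_sym.
by rewrite cardsU (disjoint_setI0 dis) cards0 subn0 cardJg.
Qed.

Lemma parab_part_min_rep y : parab_part S J y * min_rep S J y = y.
Proof. by rewrite /parab_part mulgKV. Qed.

Lemma parab_part_in y : parab_part S J y \in WJ.
Proof.
rewrite /parab_part /min_rep; case: arg_minnP => [|z]; first exact: rcoset_refl.
by case/rcosetP=> u uJ -> _; rewrite invMg mulKVg groupV.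
Qed.

Lemma min_rep_length y u : u \in WJ ->
  ell (u * min_rep S J y) = ell u + ell (min_rep S J y).
Proof.
apply: min_length_mul => w wJ.
rewrite /min_rep; case: arg_minnP => [|z zJ]; first exact: rcoset_refl.
apply; case/rcosetP: zJ => z' z'J ->.
by apply/rcosetP; exists (w * z'); rewrite ?groupM // mulgA.
Qed.

(** Two minimal representatives x = k z of one coset satisfy ell x = ell k + ell z and ell z = ell
    k^-1 + ell x, so k = 1. *)
Lemma min_rep_mulJ y u : u \in WJ -> min_rep S J (u * y) = min_rep S J y.
Proof.
move=> uJ; set x := min_rep S J (u * y); set z := min_rep S J y.
have pJ := parab_part_in (u * y); have qJ := parab_part_in y.
have px : _ * x = u * y := parab_part_min_rep (u * y).
have qz : _ * z = y := parab_part_min_rep y.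
move: (parab_part S J (u * y)) (parab_part S J y) pJ qJ px qz => p q pJ qJ px
  qz.
pose k := p^-1 * u * q; have kJ : k \in WJ by rewrite !groupM ?groupV.
have xE : x = k * z by rewrite /k -mulgA qz -mulgA -px mulKg.
have := min_rep_length (u * y) (groupVr kJ); have := min_rep_length y kJ.
rewrite -/x -/z {1}xE mulKg -xE => -> /eqP.
rewrite addnA -{1}[ell z]add0n eqn_add2r eq_sym addn_eq0 cox_length_eq0.
by case/andP=> _; rewrite cox_length_eq0 => /eqP k1; rewrite xE k1 mul1g.
Qed.

Lemma parab_part_mulJ y u : u \in WJ ->
  parab_part S J (u * min_rep S J y) = u.
Proof.
move=> uJ; rewrite /parab_part min_rep_mulJ //.
have -> : min_rep S J (min_rep S J y) = min_rep S J y; last by rewrite mulgK.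
by rewrite -[in RHS](parab_part_min_rep y) min_rep_mulJ ?parab_part_in.
Qed.

Lemma longest_in : longest S J \in WJ.
Proof. by rewrite /longest; case: arg_maxnP. Qed.

(** By maximality, the inverse of the longest element has all reflections in W_J as inversions, a
    set stable under conjugation by W_J. Left multiplication by u^-1 therefore removes exactly
    N(u^-1). Inverses appear because [inversions] acts on the left. *)
Lemma longest_length u : u \in WJ ->
  ell (longest S J * u) = ell (longest S J) - ell u.
Proof.
set m := longest S J => uJ.
have mJ : m^-1 \in WJ by rewrite groupV longest_in.
have max_m w : w \in WJ -> ell w <= ell m.
  by rewrite /m /longest; case: arg_maxnP => // x _; apply.
have inv_m : inversions m^-1 = T :&: WJ.
  apply/eqP; rewrite eqEsubset subsetI inversions_sub inversions_parabolic //=.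
  apply/subsetP => r /setIP[rT rJ]; apply: contraT; rewrite -reflection_lt //.
  by rewrite cox_lengthV ltnNge max_m // groupM.
rewrite -cox_lengthV invMg -[in ell m]cox_lengthV -[ell u]cox_lengthV.
rewrite -!card_inversions inversionsM_set.
have -> : inversions m^-1 :^ u^-1^-1 = inversions m^-1.
  apply/setP=> r; rewrite mem_conjgV inv_m !inE reflectionJ groupJr ?groupV //.
have sub_u : inversions u^-1 \subset inversions m^-1.
  by rewrite inv_m subsetI inversions_sub inversions_parabolic ?groupV.
have /eqP-> : inversions u^-1 :\: inversions m^-1 == set0 by rewrite setD_eq0.
by rewrite set0U cardsDS.
Qed.

End ParabolicCosets.

(** * Bruhat order and the lifting property *)

Lemma bruhat_lt r x : r \in T -> ell x < ell (r * x) -> bruhat S x (r * x).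
Proof.
move=> rT lt_x; apply: connect1; rewrite /= lt_x andbT.
(* [bruhat] multiplies by reflections on the right, and r x = x (r ^ x). *)
apply/existsP; exists (r ^ x); rewrite reflectionJ rT.
by rewrite conjgE mulKVg eqxx.
Qed.

(** Here s r x = (r ^ s)(s x), and r ^ s is not in N(s x), the symmetric difference of {s} and s
    N(x) s. *)
Lemma bruhat_left_mul s x r : s \in S -> r \in T -> r != s ->
  ell x < ell (r * x) -> bruhat S (s * x) (s * (r * x)).
Proof.
move=> sS rT r_s; rewrite reflection_lt // => r_x.
have -> : s * (r * x) = r ^ s * (s * x).
  by rewrite conjgE cox_invs // -!mulgA [s * (s * x)]mulgA cox_mulss // mul1g.
apply: bruhat_lt; rewrite ?reflection_lt ?reflectionJ // inversionsM
  ?reflectionJ //.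
rewrite inversions_gen // inE -conjgM cox_mulss // conjg1 (negPf r_x) addbF.
by apply: contra r_s; rewrite (canF_eq (conjgK s)) conjgE invgK mulgV mulg1.
Qed.

Section Lifting.

Variable s : W.
Hypothesis sS : s \in S.

Let upper x := if ell x < ell (s * x) then s * x else x.

Lemma bruhat_upper x : bruhat S x (upper x) /\ bruhat S (s * x) (upper x).
Proof.
have sT := reflection_gen sS.
rewrite /upper; case: ifPn => [lt|nlt].
  by split; [exact: bruhat_lt | exact: connect0].
split; first exact: connect0.
have := @bruhat_lt s (s * x) sT; rewrite mulgA cox_mulss // mul1g; apply.
by move: nlt; rewrite reflection_lt // negbK inE sT.
Qed.

(** If [upper x] is s x, a step from x to r x either has r = s and ends at [upper x], or survives
    left multiplication by s. For y below s y this monotonicity becomes the lifting property. *)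
Lemma bruhat_upper_mono x y : bruhat S x y -> bruhat S (upper x) (upper y).
Proof.
case/connectP=> p xp ->{y}; elim: p x xp => [|y p IH] x /=.
  by rewrite /bruhat connect0.
case/andP=> /andP[/existsP[t /andP[tT /eqP yE]] lt_xy] /IH.
apply: connect_trans; pose r := t ^ x^-1.
have {}yE : y = r * x by rewrite yE /r conjgE invgK !mulgA mulgKV.
have rT : r \in T by rewrite reflectionJ.
have [le_y le_sy] := bruhat_upper y.
rewrite {1}/upper; case: ifPn => [lt|_].
  have [rs|r_s] := eqVneq r s; first by rewrite -rs -yE.
  apply: connect_trans le_sy; rewrite yE.
  by apply: bruhat_left_mul; rewrite -?yE.
by apply: connect_trans le_y; rewrite yE; apply: bruhat_lt; rewrite -?yE.
Qed.

Lemma bruhat_lift x y : ell y < ell (s * y) -> bruhat S x y ->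
  bruhat S x (s * y) /\ bruhat S (s * x) (s * y).
Proof.
move=> lt_y /bruhat_upper_mono; have [le_x le_sx] := bruhat_upper x.
rewrite {2}/upper lt_y => le_xy.
by split; [apply: connect_trans le_x _ | apply: connect_trans le_sx _].
Qed.

End Lifting.

End CoxeterSystems.

(** * Dual bases over Laurent polynomials *)

Lemma laurent_polyP (x : laurent) :
  exists (p : {poly int}) (n : nat),
    x * v ^+ n = \sum_(i < size p) (p`_i)%:~R * v ^+ i.
Proof.
have /laurentP[p [n xp]] := laurent_valP x; exists p, n; apply: val_inj.
rewrite [LHS](rmorphM val) [X in _ * X](rmorphXn val) /= xp.
rewrite -[p in LHS]coefK poly_def rmorph_sum [RHS](rmorph_sum val) /=.
apply: eq_bigr => i _; rewrite -mul_polyC tofracM tofracXn.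
rewrite [X in _ = _ * X](rmorphXn val) /=; congr (_ * _).
by rewrite [RHS](rmorph_int val) -[p`_i in LHS]intz !rmorph_int.
Qed.

(** The square of d is a ring morphism fixing v and the integers; multiplying by a power of the unit
    v reduces to polynomials in v. *)
Lemma laurent_barK : involutive laurent_bar.
Proof.
move=> x; have [p [n xp]] := laurent_polyP x.
have vK : laurent_bar (laurent_bar v) = v.
  by rewrite laurent_bar_v rmorphV ?v_unit //= laurent_bar_v invrK.
apply: (mulIr (unitrX n v_unit)); rewrite xp.
have /(congr1 (laurent_bar \o laurent_bar)) := xp.
rewrite /= !rmorphM !rmorphXn /= vK => ->; rewrite !rmorph_sum /=.
by apply: eq_bigr => i _; rewrite !rmorphM !rmorph_int !rmorphXn /= vK.
Qed.

Section Bases.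

Variables (R : comNzRingType) (V : lmodType R) (I : finType).
Implicit Types (b : I -> V) (c : I -> R).

Lemma basis_expansion b x : is_basis b -> exists c, x = \sum_i c i *: b i.
Proof. by move=> /(_ x)[c [-> _]]; exists c. Qed.

Lemma basis_coef_inj b c c' : is_basis b ->
  \sum_i c i *: b i = \sum_i c' i *: b i -> c =1 c'.
Proof.
move=> /(_ (\sum_i c i *: b i))[d [_ dU]] e i.
have dE a : \sum_j c j *: b j = \sum_j a j *: b j -> a i = d i.
  move=> ea; rewrite (dU [ffun j => a j]) ?ffunE // ea.
  by apply: eq_bigr => j _; rewrite ffunE.
by rewrite (dE c) // (dE c').
Qed.

Lemma is_dual_sum b i (phi : {scalar V}) c : is_dual b i phi ->
  phi (\sum_j c j *: b j) = c i.
Proof.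
move=> dual_phi; rewrite linear_sum (bigD1 i) //= linearZ /= dual_phi eqxx
  mulr1.
rewrite big1 ?addr0 // => j j_i; rewrite linearZ /= dual_phi eq_sym.
by rewrite (negPf j_i) mulr0.
Qed.

(** Uniqueness of expansions makes the coordinate along [b i] a linear form, so [dual_basis] does
    not fall back on its default. *)
Lemma dual_basisP b i : is_basis b -> is_dual b i (dual_basis b i).
Proof.
move=> bB; rewrite /dual_basis; case: boolp.pselect => [ex|[]].
  exact: projT2 (boolp.cid ex).
pose coord x := projT1 (boolp.cid (basis_expansion x bB)) i.
have coordE c : coord (\sum_j c j *: b j) = c i.
  rewrite /coord; case: boolp.cid => /= d /esym e.
  exact: (basis_coef_inj bB e).
have coord_lin : scalar coord.
  move=> a x y; have [c ->] := basis_expansion x bB.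
  have [d ->] := basis_expansion y bB.
  rewrite scaler_sumr -big_split /=.
  under eq_bigr => j _ do rewrite scalerA -scalerDl.
  by rewrite !coordE.
pose phi := GRing.isLinear.Build R V R *%R coord coord_lin.
exists (HB.pack coord phi : {scalar V}) => j /=.
rewrite -[b j]scale1r.
have -> : 1 *: b j = \sum_k (k == j)%:R *: b k.
  rewrite (bigD1 j) //= eqxx big1 ?addr0 // => k /negPf->.
  by rewrite scale0r.
by rewrite coordE.
Qed.

Lemma dual_basis_sum b i c : is_basis b ->
  dual_basis b i (\sum_j c j *: b j) = c i.
Proof. by move=> bB; apply: is_dual_sum; apply: dual_basisP. Qed.

Lemma dual_basis_expand b x : is_basis b -> x = \sum_i dual_basis b i x *: b i.
Proof.
move=> bB; have [c {1 2}->] := basis_expansion x bB.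
by apply: eq_bigr => i _; rewrite dual_basis_sum.
Qed.

(* A surjective endomorphism of a finite free module is injective. *)
Lemma spanning_is_basis b b' : is_basis b ->
  (forall i, exists c, b i = \sum_j c j *: b' j) -> is_basis b'.
Proof.
move=> bB /boolp.choice[B bE] x.
pose A i j := dual_basis b j (b' i).
have b'E i : b' i = \sum_j A i j *: b j by apply: dual_basis_expand.
have BA i k : \sum_j B i j * A j k = (i == k)%:R.
  rewrite -(dual_basis_sum k (fun l => \sum_j B i j * A j l) bB).
  rewrite eq_sym -(dual_basisP k bB i) [in RHS]bE; congr (dual_basis b k _).
  under eq_bigr => l _ do rewrite scaler_suml.
  rewrite exchange_big /=; apply: eq_bigr => j _; rewrite b'E scaler_sumr.
  by apply: eq_bigr => l _; rewrite scalerA.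
have AB i k : \sum_j A i j * B j k = (i == k)%:R.
  (* Over a commutative ring a one-sided inverse of a square matrix is two-sided; [mx] renumbers the
     families by ordinals to use this. *)
  pose mx C : 'M[R]_#|I| := \matrix_(p, q) C (enum_val p) (enum_val q).
  have sumE F : \sum_(p < #|I|) F (enum_val p) = \sum_j F j :> R.
    by rewrite [RHS](reindex (fun p : 'I_#|I| => enum_val p)) //;
      apply: onW_bij; apply: enum_val_bij.
  have /mulmx1C/matrixP/(_ (enum_rank i) (enum_rank k)) : mx B *m mx A = 1%:M.
    apply/matrixP => p q; rewrite !mxE; under eq_bigr => l _ do rewrite !mxE.
    rewrite (sumE (fun j => B (enum_val p) j * A j (enum_val q))) BA.
    by rewrite (inj_eq enum_val_inj).
  rewrite !mxE; under eq_bigr => l _ do rewrite !mxE !enum_rankK.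
  by rewrite (sumE (fun j => A i j * B j k)) (inj_eq enum_rank_inj).
have uniq_coef d d' : \sum_i d i *: b' i = \sum_i d' i *: b' i -> d =1 d'.
  have sumE c : \sum_i c i *: b' i = \sum_k (\sum_i c i * A i k) *: b k.
    under [RHS]eq_bigr => k _ do rewrite scaler_suml.
    rewrite exchange_big /=; apply: eq_bigr => i _; rewrite b'E scaler_sumr.
    by apply: eq_bigr => k _; rewrite scalerA.
  have coefE c k : \sum_l (\sum_i c i * A i l) * B l k = c k.
    under eq_bigr => l _ do rewrite mulr_suml.
    rewrite exchange_big /= (eq_bigr (fun i => c i * (i == k)%:R)) => [|i _].
      rewrite (bigD1 k) //= eqxx mulr1 big1 ?addr0 // => i /negPf->.
      by rewrite mulr0.
    by under eq_bigr => l _ do rewrite -mulrA; rewrite -mulr_sumr AB.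
  rewrite !sumE => /(basis_coef_inj bB) e k.
  by rewrite -(coefE d) -(coefE d'); apply: eq_bigr => l _; rewrite e.
have [c ->] := basis_expansion x bB.
exists [ffun j => \sum_i c i * B i j]; split=> [|d].
  under [RHS]eq_bigr => j _ do rewrite ffunE scaler_suml.
  rewrite exchange_big /=; apply: eq_bigr => i _; rewrite {1}bE scaler_sumr.
  by apply: eq_bigr => j _; rewrite scalerA.
move=> e; apply/ffunP=> j; rewrite ffunE.
apply: (uniq_coef (fun j => \sum_i c i * B i j)); rewrite -e.
under eq_bigr => k _ do rewrite scaler_suml.
rewrite exchange_big /=; apply: eq_bigr => i _; rewrite [b i]bE scaler_sumr.
by apply: eq_bigr => k _; rewrite scalerA.
Qed.

End Bases.

Lemma dual_basis_change (R : comNzRingType) (V : lmodType R) (I : finType)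
    (b b' : I -> V) (A : I -> I -> R) (c : I -> R) x i :
  is_basis b' -> (forall j, b j = \sum_k A k j *: b' k) ->
  x = \sum_j c j *: b j -> dual_basis b' i x = \sum_j A i j * c j.
Proof.
move=> b'B bE ->; rewrite -(dual_basis_sum i (fun k => \sum_j A k j * c j) b'B).
congr (dual_basis b' i _); under [RHS]eq_bigr => k _ do rewrite scaler_suml.
rewrite exchange_big /=; apply: eq_bigr => j _; rewrite bE scaler_sumr.
by apply: eq_bigr => k _; rewrite scalerA mulrC.
Qed.

(** * Hecke algebras *)

Definition bar_basis (W : finGroupType) (H : unitAlgType laurent) (h : W -> H)
  (x : W) : H := (h x^-1%g)^-1.

Section HeckeAlgebra.

Variables (W : finGroupType) (S : {set W}).
Hypothesis coxS : coxeter_system S.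
Variables (H : unitAlgType laurent) (h : W -> H).
Hypothesis heckeH : hecke_algebra S h.
Implicit Types (s u w x y z : W) (J : {set W}).

Local Notation ell := (cox_length S).

Local Notation hb := (bar_basis h).
Let q : laurent := v^-1 - v.
Let qs s x : laurent := if (ell x < ell (s * x)%g)%N then q else 0.

Lemma hecke_basis : is_basis h. Proof. by case: heckeH. Qed.

Lemma heckeM x y : ell (x * y)%g = (ell x + ell y)%N -> h (x * y)%g = h x * h y.
Proof. by case: heckeH => _ hM _ e; rewrite hM. Qed.

(** [h 1] is a left unit on every [h x], hence on 1 after expanding 1 in the basis. *)
Lemma hecke1 : h 1%g = 1.
Proof.
have [c e] := basis_expansion 1 hecke_basis.
rewrite -[LHS]mulr1 [in LHS]e mulr_sumr [RHS]e; apply: eq_bigr => x _.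
by rewrite -scalerAr -heckeM ?mul1g // cox_length1.
Qed.

Lemma hecke_gen_inv s : s \in S ->
  h s * (h s - q%:A) = 1 /\ (h s - q%:A) * h s = 1.
Proof.
move=> sS; suff e : h s * (h s - q%:A) = 1.
  split=> //; rewrite -[RHS]e mulrBl mulrBr; congr (_ - _).
  by rewrite -scalerAl mul1r -scalerAr mulr1.
have [_ _ /(_ s sS)] := heckeH.
rewrite mulrBr !mulrDl -!scalerAr -!scalerAl !mulr1 mul1r scalerA.
rewrite mulVr ?v_unit //.
rewrite scale1r => /eqP; rewrite subr_eq0 mulrBr -scalerAr mulr1.
rewrite /q scalerBl opprB.
by move/eqP; rewrite addrA => ->; rewrite addrAC subrr add0r.
Qed.

Lemma hecke_gen_unit s : s \in S -> h s \is a GRing.unit.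
Proof. by move=> /hecke_gen_inv[e1 e2]; apply/unitrP; exists (h s - q%:A). Qed.

Lemma hecke_unit x : h x \is a GRing.unit.
Proof.
have := mem_cox_gen coxS x.
elim/(parabolic_ind coxS (subxx S)) => [|s y sS _ ell_sy uy].
  by rewrite hecke1 unitr1.
have e : ell (s * y)%g = (ell s + ell y)%N by apply: (cox_length_ascent coxS);
  rewrite // ell_sy.
by rewrite heckeM // unitrMr //; apply: hecke_gen_unit.
Qed.

Lemma bar_basisM x y : ell (x * y)%g = (ell x + ell y)%N -> hb (x * y)%g =
  hb x * hb y.
Proof.
move=> e; rewrite /bar_basis invMg heckeM ?invrM ?hecke_unit //.
by rewrite -invMg !cox_lengthV // e addnC.
Qed.

Lemma bar_basis_gen s : s \in S -> hb s = h s - q%:A.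
Proof.
move=> sS; have [e _] := hecke_gen_inv sS.
apply: (mulrI (hecke_gen_unit sS)).
by rewrite /bar_basis (cox_invs coxS sS) e mulrV //; apply: hecke_gen_unit.
Qed.

(** The quadratic relation reads h s = hb s + q, which settles an ascent; at a descent hb x = hb s *
    hb (s x), and h s cancels hb s. *)
Lemma hecke_gen_bar s x : s \in S -> h s * hb x = hb (s * x)%g + qs s x *: hb x.
Proof.
move=> sS; have hs : h s = hb s + q%:A by rewrite bar_basis_gen // subrK.
rewrite /qs; case: ifPn => [lt|nlt].
  have e := cox_length_ascent coxS sS lt.
  by rewrite {1}hs mulrDl mulr_algl -(bar_basisM e).
have -> : hb x = hb s * hb (s * x)%g.
  by rewrite -bar_basisM mulgA (cox_mulss coxS sS) mul1g //;
    apply: (cox_length_descent coxS).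
by rewrite scale0r addr0 {1}/bar_basis (cox_invs coxS sS) mulVKr
  ?hecke_gen_unit.
Qed.

(** The mirror image of [hecke_gen_bar] under the bar involution, with d q = -q. *)
Lemma bar_gen_hecke s x : s \in S ->
  hb s * h x = h (s * x)%g + laurent_bar (qs s x) *: h x.
Proof.
move=> sS; rewrite /qs; case: ifPn => [lt|nlt].
  have e := cox_length_ascent coxS sS lt.
  rewrite bar_basis_gen // mulrBl mulr_algl -(heckeM e).
  by rewrite -scaleNr /q rmorphB rmorphV ?v_unit //= laurent_bar_v invrK opprB.
have -> : h x = h s * h (s * x)%g.
  by rewrite -heckeM mulgA (cox_mulss coxS sS) mul1g //;
    apply: (cox_length_descent coxS).
by rewrite rmorph0 scale0r addr0 /bar_basis (cox_invs coxS sS) mulKr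
  ?hecke_gen_unit.
Qed.

(** Left multiplication by s gives the same recursion for both expansions, up to applying d. The
    support clause allows a translate z so that it serves both for z = 1 and for z a minimal coset
    representative. *)
Lemma parabolic_expansion J w : J \subset S -> w \in <<J>>%g ->
  exists c : W -> laurent,
  [/\ h w = \sum_x c x *: hb x,
      hb w = \sum_x laurent_bar (c x) *: h x
    & forall x, c x != 0 -> x \in <<J>>%g /\ forall z,
        {in <<J>>%g, forall u, ell (u * z)%g = (ell u + ell z)%N} ->
        bruhat S (x * z)%g (w * z)%g].
Proof.
move=> subJS; elim/(parabolic_ind coxS subJS) => [|s y sJ yJ ell_sy].
  have sum1 (b : W -> H) : b 1%g = \sum_x (x == 1)%g%:R *: b x.
    rewrite (bigD1 1%g) //= eqxx scale1r big1 ?addr0 // => x /negPf->.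
    by rewrite scale0r.
  exists (fun x => (x == 1)%g%:R); split;
    first by rewrite -sum1 hecke1 /bar_basis invg1 hecke1 invr1.
    under eq_bigr => x _ do rewrite rmorph_nat.
    by rewrite -sum1 hecke1 /bar_basis invg1 hecke1 invr1.
  move=> x; have [-> _|_] := eqVneq x 1%g; last by rewrite eqxx.
  by split=> [|z _]; [exact: group1 | exact: connect0].
have sS := subsetP subJS _ sJ; have ss := cox_mulss coxS sS.
case=> c [hE hbE cP].
exists (fun x => c (s * x)%g + qs s x * c x).
have sumE (a : W -> laurent) (r : W -> laurent) (b : W -> H) :
    \sum_x a x *: (b (s * x)%g + r x *: b x) =
    \sum_x (a (s * x)%g + r x * a x) *: b x.
  under eq_bigr => x _ do rewrite scalerDr scalerA.
  under [RHS]eq_bigr => x _ do rewrite scalerDl.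
  rewrite !big_split /=; congr (_ + _).
    by rewrite [RHS](reindex_inj (mulgI s)); apply: eq_bigr => x _;
      rewrite mulgA ss mul1g.
  by apply: eq_bigr => x _; rewrite mulrC.
have ell_s : ell (s * y)%g = (ell s + ell y)%N.
  by apply: (cox_length_ascent coxS); rewrite // ell_sy.
split=> [||x].
- rewrite heckeM // hE mulr_sumr -sumE; apply: eq_bigr => x _.
  by rewrite -scalerAr hecke_gen_bar.
- rewrite bar_basisM // hbE mulr_sumr.
  under [RHS]eq_bigr => x _ do rewrite rmorphD rmorphM.
  rewrite -(sumE (fun x => laurent_bar (c x)) (fun x => laurent_bar (qs s x))).
  by apply: eq_bigr => x _; rewrite -scalerAr bar_gen_hecke.
move=> nz; have sWJ : s \in <<J>>%g := mem_gen sJ.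
(* A nonzero new coefficient at x comes from c x or c (s x); lifting turns either bound by y z into
   x z <= s y z. *)
have [xJ le_x] : x \in <<J>>%g /\ forall z,
    {in <<J>>%g, forall u, ell (u * z)%g = (ell u + ell z)%N} ->
    bruhat S (x * z)%g (y * z)%g \/ bruhat S (s * x * z)%g (y * z)%g.
  have [cx0|/cP[xJ le_x]] := eqVneq (c x) 0; last by split=> // z /le_x; left.
  have /cP[sxJ le_x] : c (s * x)%g != 0.
    by apply: contraNneq nz => ->; rewrite cx0 mulr0 addr0.
  by split=> [|z /le_x]; [rewrite -(groupMl _ sWJ) | right].
split=> // z zP; have lt_z : (ell (y * z) < ell (s * (y * z)))%g%N.
  by rewrite mulgA !zP ?groupM // ell_sy.
rewrite -mulgA; have [|] := le_x z zP => /(bruhat_lift coxS sS lt_z)[] // _.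
by rewrite -[(s * x * z)%g]mulgA (mulgA s s) ss mul1g.
Qed.

(** [hecke_bar] sends h w to hb w, so [Rcheck] applies d to coefficients that already carry one
    d. *)
Lemma Rcheck_expansion J w : J \subset S -> w \in <<J>>%g ->
  [/\ h w = \sum_x Rcheck h x w *: hb x,
      hb w = \sum_x laurent_bar (Rcheck h x w) *: h x
    & forall x, Rcheck h x w != 0 -> x \in <<J>>%g /\ forall z,
        {in <<J>>%g, forall u, ell (u * z)%g = (ell u + ell z)%N} ->
        bruhat S (x * z)%g (w * z)%g].
Proof.
move=> subJS wJ; have [c [hE hbE cP]] := parabolic_expansion subJS wJ.
have barE : hecke_bar h (h w) = hb w.
  rewrite /hecke_bar (bigD1 w) //= (dual_basisP _ hecke_basis) eqxx rmorph1
    scale1r.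
  rewrite big1 ?addr0 // => x /negPf x_w.
  by rewrite (dual_basisP _ hecke_basis) x_w rmorph0 scale0r.
have RE x : Rcheck h x w = c x.
  rewrite /Rcheck /dual_bar /= barE hbE (dual_basis_sum _ _ hecke_basis).
  exact: laurent_barK.
split=> [||x]; last by rewrite RE; apply: cP.
  by under eq_bigr => x _ do rewrite RE.
by under eq_bigr => x _ do rewrite RE.
Qed.

Lemma bar_basis_is_basis : is_basis hb.
Proof.
apply: spanning_is_basis hecke_basis _ => w.
have [-> _ _] := Rcheck_expansion (subxx S) (mem_cox_gen coxS w).
by exists (fun x => Rcheck h x w).
Qed.

Lemma RcheckE x w : Rcheck h x w = dual_basis hb x (h w).
Proof.
have [-> _ _] := Rcheck_expansion (subxx S) (mem_cox_gen coxS w).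
by rewrite (dual_basis_sum _ _ bar_basis_is_basis).
Qed.

Lemma Rcheck_bruhat x w : Rcheck h x w != 0 -> bruhat S x w.
Proof.
have [_ _ RP] := Rcheck_expansion (subxx S) (mem_cox_gen coxS w).
case/RP=> _ /(_ 1%g); rewrite !mulg1; apply=> u _.
by rewrite mulg1 cox_length1 // addn0.
Qed.

(** * Relative R-polynomials of a parabolic subgroup *)

Section Relative.

Variable J : {set W}.
Hypothesis subJS : J \subset S.

Let tau := (longest S S * longest S J)%g.
Let f x := hecke_f h x tau.
Let coset_coef z y := Rcheck h (z * (min_rep S J y)^-1)%g (parab_part S J y).

(** Write y = k x. Since ell (tau k) = ell tau + ell k, h (tau k) = h tau * h k; since ell (tau k) =
    ell (tau k x) + ell x^-1, also h (tau k) = h (tau k x) * h (x^-1). Dividing gives the claim. *)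
Lemma hecke_fE y : f y = h (parab_part S J y) * hb (min_rep S J y).
Proof.
have kJ := parab_part_in S J y; have xP := @min_rep_length _ _ coxS _ subJS y.
rewrite /f -{1}[y](parab_part_min_rep S J).
move: (parab_part S J y) (min_rep S J y) kJ xP => k x kJ xP.
pose w0 := longest S S; pose wJ := longest S J.
have ell0 u : ell (w0 * u)%g = (ell w0 - ell u)%N.
  exact: (longest_length coxS (subxx S) (mem_cox_gen coxS u)).
have le0 u : (ell u <= ell w0)%N.
  by rewrite /w0 /longest; case: arg_maxnP => [|z _]; [|apply;
    apply: (mem_cox_gen coxS)].
have ellJ u : u \in <<J>>%g -> ell (wJ * u)%g = (ell wJ - ell u)%N.
  exact: (longest_length coxS subJS).
have leJ u : u \in <<J>>%g -> (ell u <= ell wJ)%N.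
  by rewrite /wJ /longest; case: arg_maxnP => [|z _]; [|apply].
have wJ_in : wJ \in <<J>>%g := longest_in S J.
have tauk : ell (tau * k)%g = (ell tau + ell k)%N.
  rewrite /tau -mulgA !ell0 ellJ //.
  by rewrite subnBA ?leJ // addnBAC ?le0.
have taukx : ell (tau * k)%g = (ell (tau * (k * x))%g + ell x^-1%g)%N.
  rewrite /tau (cox_lengthV coxS) -!mulgA !ell0 !mulgA -(mulgA _ k x).
  rewrite (mulgA _ k x) xP ?groupM // subnDA subnK //.
  by rewrite leq_subRL ?le0 // -xP ?groupM // le0.
have e : h (tau * k)%g = h (tau * (k * x))%g * h x^-1%g.
  by rewrite -(heckeM (x := (tau * (k * x))%g)) !mulgA mulgK // -mulgA.
rewrite /hecke_f /bar_basis -[h (tau * (k * x))%g](mulrK (hecke_unit x^-1%g))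
  -e.
by rewrite (heckeM tauk) mulrA mulKr //; apply: hecke_unit.
Qed.

Lemma min_rep_coset z y : (z * (min_rep S J y)^-1)%g \in <<J>>%g ->
  min_rep S J z = min_rep S J y.
Proof.
move=> zJ; rewrite -[z](mulgKV (min_rep S J y)).
rewrite (min_rep_mulJ coxS subJS) // -[in RHS](parab_part_min_rep S J y).
by rewrite [RHS](min_rep_mulJ coxS subJS) //; apply: parab_part_in.
Qed.

Lemma coset_coef_support z y : coset_coef z y != 0 ->
  (z * (min_rep S J y)^-1)%g \in <<J>>%g /\ bruhat S z y.
Proof.
have [_ _ RP] := Rcheck_expansion subJS (parab_part_in S J y).
case/RP=> zJ /(_ (min_rep S J y)).
rewrite mulgKV parab_part_min_rep => le_zy; split=> //; apply: le_zy.
by move=> u uJ; apply: min_rep_length.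
Qed.

Lemma hecke_f_expansion y : f y = \sum_z coset_coef z y *: hb z.
Proof.
have pJ := parab_part_in S J y.
have [hE _ RP] := Rcheck_expansion subJS pJ.
rewrite hecke_fE hE mulr_suml [RHS](reindex_inj (mulIg (min_rep S J y))).
apply: eq_bigr => u _; rewrite /coset_coef mulgK -scalerAl.
have [->|/RP[uJ _]] := eqVneq (Rcheck h u (parab_part S J y)) 0.
  by rewrite !scale0r.
by rewrite bar_basisM //; apply: min_rep_length.
Qed.

(** Here hb (k x) = hb k * hb x, and every h u occurring in hb k has u in W_J, so h u * hb x is
    f_{ux}. *)
Lemma bar_basis_expansion y : hb y = \sum_z laurent_bar (coset_coef z y) *: f z.
Proof.
have pJ := parab_part_in S J y.
have [_ hbE RP] := Rcheck_expansion subJS pJ.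
rewrite -{1}[y](parab_part_min_rep S J) bar_basisM; last exact: min_rep_length.
rewrite hbE mulr_suml [RHS](reindex_inj (mulIg (min_rep S J y))).
apply: eq_bigr => u _; rewrite /coset_coef mulgK -scalerAl.
have [->|/RP[uJ _]] := eqVneq (Rcheck h u (parab_part S J y)) 0.
  by rewrite rmorph0 !scale0r.
rewrite hecke_fE (parab_part_mulJ coxS subJS) //.
by rewrite (@min_rep_coset _ y) // mulgK.
Qed.

Lemma hecke_f_basis : is_basis f.
Proof.
apply: spanning_is_basis bar_basis_is_basis _ => y.
by exists (fun z => laurent_bar (coset_coef z y)); apply: bar_basis_expansion.
Qed.

Lemma Rcheck_sum z w : Rcheck h z w =
  \sum_y coset_coef z y * Rcheck_rel S h J y w.
Proof.
rewrite RcheckE; apply: dual_basis_change bar_basis_is_basis hecke_f_expansion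
  _.
exact: dual_basis_expand hecke_f_basis.
Qed.

Lemma Rcheck_rel_sum z w :
  Rcheck_rel S h J z w = \sum_y laurent_bar (coset_coef z y) * Rcheck h y w.
Proof.
apply: dual_basis_change hecke_f_basis bar_basis_expansion _.
by have [] := Rcheck_expansion (subxx S) (mem_cox_gen coxS w).
Qed.

(** A nonzero term of the inverse relation [Rcheck_rel_sum] yields z <= y <= w. *)
Lemma Rcheck_rel_bruhat z w : Rcheck_rel S h J z w != 0 -> bruhat S z w.
Proof.
apply: contraTT => nle; rewrite negbK Rcheck_rel_sum big1 // => y _.
have [->|/coset_coef_support[_ le_zy]] := eqVneq (coset_coef z y) 0;
  first by rewrite rmorph0 mul0r.
have [->|/Rcheck_bruhat le_yw] := eqVneq (Rcheck h y w) 0;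
  first by rewrite mulr0.
by case/negP: nle; apply: connect_trans le_zy le_yw.
Qed.

(** After the substitution y = k x, the support of F forces k in W_J and z <= y, and that of G
    forces y <= w. *)
Lemma coset_sum z w (F G : W -> laurent) :
  (forall y, F y != 0 -> coset_coef z y != 0) -> (forall y, G y != 0 ->
    bruhat S y w) ->
  \sum_y F y * G y =
  \sum_(k in <<J>>%g | bruhat S z (k * min_rep S J z)%g
                        && bruhat S (k * min_rep S J z)%g w)
     F (k * min_rep S J z)%g * G (k * min_rep S J z)%g.
Proof.
move=> FA GB; rewrite (reindex_inj (mulIg (min_rep S J z))) [RHS]big_mkcond.
apply: eq_bigr => k _; set y := (k * _)%g; case: ifP => // /negbT.
have [->|/GB le_yw] := eqVneq (G y) 0; first by rewrite mulr0.
have [->|/FA/coset_coef_support[zJ le_zy]] := eqVneq (F y) 0;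
  first by rewrite mul0r.
have -> : k = parab_part S J y by rewrite /parab_part -(min_rep_coset zJ) mulgK.
by rewrite parab_part_in le_zy le_yw.
Qed.

Lemma coset_coef_mul z k : k \in <<J>>%g ->
  coset_coef z (k * min_rep S J z)%g = Rcheck h (parab_part S J z) k.
Proof.
move=> kJ; rewrite /coset_coef (parab_part_mulJ coxS subJS) //.
by rewrite (@min_rep_coset _ z) // mulgK.
Qed.

Lemma Rcheck_parabolic z w :
  Rcheck h z w =
    \sum_(k in <<J>>%g | bruhat S z (k * min_rep S J z)%g
                          && bruhat S (k * min_rep S J z)%g w)
       Rcheck h (parab_part S J z) k * Rcheck_rel S h J (k * min_rep S J z)%g w.
Proof.
rewrite Rcheck_sum (@coset_sum z w) //; last by move=> y /Rcheck_rel_bruhat.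
by apply: eq_bigr => k /andP[kJ _]; rewrite coset_coef_mul.
Qed.

(** This concerns the unnormalized polynomials: d inverts v, so the powers of v do not telescope.
    For W = J = S = {s} up to the identity, z = 1 and w = s, the normalized sum would be v^2 + v^-2
    - 2, while the left side is 0. *)
Lemma Rcheck_rel_parabolic z w :
  Rcheck_rel S h J z w =
    \sum_(k in <<J>>%g | bruhat S z (k * min_rep S J z)%g
                          && bruhat S (k * min_rep S J z)%g w)
       laurent_bar (Rcheck h (parab_part S J z) k)
         * Rcheck h (k * min_rep S J z)%g w.
Proof.
rewrite Rcheck_rel_sum (@coset_sum z w) => [|y|y]; last exact: Rcheck_bruhat.
  by apply: eq_bigr => k /andP[kJ _]; rewrite coset_coef_mul.
by apply: contraNneq => ->; rewrite rmorph0.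
Qed.

Lemma Rpoly_parabolic z w :
  Rpoly S h z w =
    \sum_(k in <<J>>%g | bruhat S z (k * min_rep S J z)%g
                          && bruhat S (k * min_rep S J z)%g w)
       Rpoly S h (parab_part S J z) k * Rpoly_rel S h J (k * min_rep S J z)%g w.
Proof.
rewrite /Rpoly Rcheck_parabolic mulr_sumr; apply: eq_bigr => k /andP[kJ _].
rewrite /Rpoly_rel mulrACA -exprzDr ?v_unit //; congr (v ^ _ * _).
(* The lengths of z and of k x, x the minimal representative, share the summand ell x, so the
   exponents telescope. *)
have := min_rep_length coxS subJS z (parab_part_in S J z).
rewrite parab_part_min_rep => ->; rewrite min_rep_length // !PoszD addrA.
by congr (_ - _); rewrite addrA subrK.
Qed.

End Relative.
End HeckeAlgebra.

Theorem proposition3p12 (W : finGroupType) (S : {set W})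
    (coxS : coxeter_system S)
    (H : unitAlgType laurent) (h : W -> H) (heckeH : hecke_algebra S h)
    (J : {set W}) (subJS : J \subset S) (sigma omega : W) :
  let Jsigma := min_rep S J sigma in
  let sigmaJ := parab_part S J sigma in
  [/\ Rcheck h sigma omega =
        \sum_(kappa in <<J>>%g | bruhat S sigma (kappa * Jsigma)%g
                                 && bruhat S (kappa * Jsigma)%g omega)
          Rcheck h sigmaJ kappa * Rcheck_rel S h J (kappa * Jsigma)%g omega,
      Rpoly S h sigma omega =
        \sum_(kappa in <<J>>%g | bruhat S sigma (kappa * Jsigma)%g
                                 && bruhat S (kappa * Jsigma)%g omega)
          Rpoly S h sigmaJ kappa * Rpoly_rel S h J (kappa * Jsigma)%g omega
    & Rcheck_rel S h J sigma omega =
        \sum_(kappa in <<J>>%g | bruhat S sigma (kappa * Jsigma)%g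
                                 && bruhat S (kappa * Jsigma)%g omega)
          laurent_bar (Rcheck h sigmaJ kappa)
            * Rcheck h (kappa * Jsigma)%g omega].
Proof.
split; [exact: Rcheck_parabolic | exact: Rpoly_parabolic | ].
exact: Rcheck_rel_parabolic.
Qed.
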